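(* For $c\in(0,\infty)$ define $$\ell(c)=\frac{c^2}{1+c^2}-\int_0^\infty c^2\,t\,e^{-ct-t^2/2}\,dt .$$ For any $c\in(0,\infty)$ and any integer $n>\max(c^2,1/c^2)$, let $\mathbf{p}^{(n)}=\mathbf{p}(n,c/\sqrt n)$ be the distribution on the $n+1$ colors $0,1,\dots,n$ given by $$\mathbf{p}(n,x)=\left(x,\frac{1-x}{n},\dots,\frac{1-x}{n}\right)\quad\text{with } x=c/\sqrt n .$$ Then $$\lim_{n\to\infty}D\big(\mathbf{p}^{(n)}\big)=\ell(c).$$
   Context: For $n\ge1$ and $x\in[\frac1{n+1},1)$, $\mathbf{p}(n,x)$ denotes the probability distribution on colors $0,1,\dots,n$ with $p_0=x$ and $p_1=\cdots=p_n=(1-x)/n$. For a probability distribution $\mathbf{p}=(p_i)_i$ on a finite or countable set of colors, define two derived distributions on colors. Method 1: $\mathbb{P}(X=i)=p_i^2/f_2$ with $f_2=\sum_i p_i^2$ (the color of a pair of independent samples from $\mathbf{p}$, conditional on the two agreeing). Method 2: $Y$ is the first color to be seen twice when sampling independently from $\mathbf{p}$, one at a time; explicitly $$\mathbb{P}(Y=i)=p_i^2\sum_{k\ge 0}(k+1)!\sum_{J:\,|J|=k,\ i\notin J}\ \prod_{j\in J}p_j ,$$ the inner sum being over sets $J$ of $k$ distinct colors not containing $i$. The discrepancy of $\mathbf{p}$ is the total variation distance between these two laws: $$D(\mathbf{p})=\frac12\sum_i\big|\mathbb{P}(X=i)-\mathbb{P}(Y=i)\big|.$$ *)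

(* Defs.v *)
From mathcomp Require Import all_boot all_order all_algebra.
From mathcomp Require Import all_classical all_reals all_analysis.

Set Implicit Arguments.
Unset Strict Implicit.
Unset Printing Implicit Defensive.

Import Order.TTheory GRing.Theory Num.Theory.
Import numFieldNormedType.Exports.

Local Open Scope classical_set_scope.
Local Open Scope ring_scope.

Definition is_distribution (R : realType) (T : finType) (p : T -> R) : Prop :=
  (forall i, 0 <= p i) /\ \sum_i p i = 1.

(* Law of the color of two independent samples, conditional on agreement. *)
Definition pair_law (R : realType) (T : finType) (p : T -> R) (i : T) : R :=
  p i ^+ 2 / (\sum_j p j ^+ 2).

(* Law of the first color seen twice in an i.i.d. sequence: the colors J seen
   once before the repetition of i, together with the first i, can be ordered
   in (#|J| + 1)! ways.  A set J not containing i has at most #|T| - 1 elements,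
   so the sum over all k >= 0 stops at k = #|T| - 1. *)
Definition first_repeat_law (R : realType) (T : finType) (p : T -> R) (i : T)
    : R :=
  p i ^+ 2 *
  \sum_(k < #|T|) (k.+1)`!%:R *
    \sum_(J : {set T} | (#|J| == k) && (i \notin J)) \prod_(j in J) p j.

Definition discrepancy (R : realType) (T : finType) (p : T -> R) : R :=
  2^-1 * \sum_i `|pair_law p i - first_repeat_law p i|.

(* p(n, x) on the colors 0, ..., n; meaningful for n >= 1. *)
Definition two_level (R : realType) (n : nat) (x : R) (i : 'I_n.+1) : R :=
  if i == ord0 then x else (1 - x) / n%:R.

Definition limit_discrepancy (R : realType) (c : R) : R :=
  c ^+ 2 / (1 + c ^+ 2)
  - \int[lebesgue_measure]_(t in `[0, +oo[)
      (c ^+ 2 * t * expR (- (c * t) - t ^+ 2 / 2)).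

Lemma two_level_distribution (R : realType) (n : nat) (x : R) :
  (0 < n)%N -> 0 <= x <= 1 -> is_distribution (@two_level R n x).
Proof.
move=> n0 /andP[x0 x1]; split=> [i|].
  by rewrite /two_level; case: ifP => // _; rewrite divr_ge0 ?subr_ge0.
rewrite big_ord_recl /two_level eqxx.
rewrite (eq_bigr (fun=> (1 - x) / n%:R)) //.
rewrite sumr_const card_ord -[X in _ + X]mulr_natr divfK ?pnatr_eq0 -?lt0n //.
by rewrite addrC subrK.
Qed.

(* For n > max(c^2, 1/c^2) the parameter c / sqrt n is in the range required of
   x.  The finitely many other n do not affect a limit as n tends to infinity. *)
Lemma two_level_parameter_range (R : realType) (c : R) (n : nat) :
  0 < c -> Num.max (c ^+ 2) (1 / c ^+ 2) < n%:R ->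
  (0 < n)%N /\ n.+1%:R^-1 <= c / Num.sqrt n%:R < 1.
Proof.
move=> c0; rewrite gt_max => /andP[cn nc].
have n0 : 0 < n%:R :> R by apply: le_lt_trans cn; rewrite sqr_ge0.
have s0 : 0 < Num.sqrt n%:R :> R by rewrite sqrtr_gt0.
have sE : Num.sqrt n%:R ^+ 2 = n%:R :> R by rewrite sqr_sqrtr // ltW.
rewrite ltr_pdivrMr ?exprn_gt0 // in nc.
split; first by rewrite -(ltr0n R).
apply/andP; split; last first.
  by rewrite ltr_pdivrMr // mul1r -(@ltr_pXn2r _ 2) ?nnegrE ?ltW // sE.
set s := Num.sqrt _ in s0 sE *.
have cs : 1 < c * s.
  rewrite -(@ltr_pXn2r _ 2) ?nnegrE ?ltW ?mulr_gt0 //.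
  by rewrite exprMn sE expr1n mulrC.
apply: (@le_trans _ _ n%:R^-1); first by rewrite lef_pV2 ?posrE ?ler_nat.
rewrite -sE ler_pdivlMr // expr2 invfM mulfVK ?gt_eqF //.
by rewrite -(ler_pM2r s0) mulVf ?gt_eqF // ltW.
Qed.

(* Main.v *)
Require Import Defs.
From mathcomp Require Import all_boot all_order all_algebra.
From mathcomp Require Import all_classical all_reals all_analysis.
From mathcomp Require Import measurable_realfun.
From mathcomp Require Import ring lra.
Import Order.TTheory GRing.Theory Num.Theory.
Import numFieldNormedType.Exports.
Local Open Scope classical_set_scope.
Local Open Scope ring_scope.

Set Implicit Arguments.
Unset Strict Implicit.
Unset Printing Implicit Defensive.

(** The proof is Poissonization.  Let the samples arrive at the points of a
    Poisson process of rate [l].  The colors then arrive as independent Poisson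
    processes, and the first repeated color is [i], with its second arrival at
    time [t], with density
      [l ^ 2 * t * p_i ^ 2 * exp (- l t) * \prod_(j != i) (1 + p_j l t)].
    Integrated over [t], this is the law of the first repeated color.
    Algebraically, if [L] is the linear functional [X^k |-> k!] on polynomials,
    which is [P |-> \int_0^oo P(s) e^-s ds], then the law gives [i] the mass
    [L (p_i ^ 2 X \prod_(j != i) (1 + p_j X))] ([first_repeat_lawE]).

    Two facts reduce the discrepancy to a single color.  First, the law of the
    first repeat has total mass 1 ([first_repeat_law_sum]): with
    [Q = \prod_j (1 + p_j X)], the polynomials above sum to [Q - Q'], and [L]
    maps [Q - Q'] to [Q(0) = 1].  Second, colors of equal probability have equal
    mass under both laws, so for [p(n, x)] the differences of the two laws at
    the colors [1, ..., n] are all equal and compensate the difference at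
    color [0].
    Hence the discrepancy is [|P(X = 0) - P(Y = 0)|] ([discrepancy_two_level]).

    For [x = c / sqrt n], [P(X = 0)] tends to [c^2 / (1 + c^2)] by direct
    computation.  Taking the rate [l = sqrt n] in the density,
      [P(Y = 0) = \int_0^oo c^2 t (1 + w)^n exp (- sqrt n t) dt],
      with [w = t (1 - c / sqrt n) / sqrt n].
    Since [ln (1 + w) = w - w^2 / 2 + O(w^3)], the integrand converges pointwise
    to [c^2 t exp (- c t - t^2 / 2)]; since [1 + w <= e^w], it is dominated by
    [c^2 t exp (- c t)].  Dominated convergence gives the limit of [P(Y = 0)].

    So the discrepancy tends to the absolute value of [limit_discrepancy c], and
    it remains to see that this number is nonnegative.  This is the classical
    lower bound for the Mills ratio of the Gaussian law, obtained here by
    comparing the integrand with the derivative of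
    [- c^2 / (1 + c^2) * (1 + c t) * exp (- c t - t^2 / 2)]
    ([limit_discrepancy_ge0]). *)

(** * The functional sending X^k to k! *)

Lemma deriv_prod_uniq (R : comNzRingType) (I : eqType) (r : seq I)
    (F : I -> {poly R}) : uniq r ->
  (\prod_(i <- r) F i)^`()
    = \sum_(i <- r) (F i)^`() * \prod_(j <- r | j != i) F j.
Proof.
elim: r => [|x r IHr] /=; first by rewrite !big_nil -polyC1 derivC.
case/andP=> xr ur; rewrite !big_cons derivM IHr // eqxx /=; congr (_ * _ + _).
  rewrite big_seq [RHS]big_seq_cond; apply: eq_bigl => j.
  by case: eqP => [->|]; rewrite ?andbT // (negbTE xr).
rewrite mulr_sumr [LHS]big_seq [RHS]big_seq; apply: eq_bigr => i ir.
rewrite big_cons ifT; first by rewrite mulrCA.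
by apply: contraNneq xr => ->.
Qed.

Section FactorialFunctional.
Variable R : realType.
Implicit Types p q : {poly R}.

(** The integral of [p] against [exp (- t)] on the half-line, in algebraic
    form. *)
Definition factorial_functional p : R := \sum_(i < size p) p`_i * i`!%:R.

Lemma factorial_functional_wide p m : (size p <= m)%N ->
  factorial_functional p = \sum_(i < m) p`_i * i`!%:R.
Proof.
move=> pm; rewrite /factorial_functional.
rewrite (big_ord_widen _ (fun i => p`_i * i`!%:R) pm).
rewrite big_mkcond; apply: eq_bigr => i _; case: ltnP => // pi.
by rewrite nth_default ?mul0r.
Qed.

Lemma factorial_functionalZD a p q :
  factorial_functional (a *: p + q)
    = a * factorial_functional p + factorial_functional q.
Proof.
pose m := maxn (size (a *: p + q)) (maxn (size p) (size q)).
rewrite !(@factorial_functional_wide _ m) ?leq_max ?leqnn ?orbT //.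
rewrite mulr_sumr -big_split; apply: eq_bigr => i _ /=.
by rewrite coefD coefZ mulrDl mulrA.
Qed.

Lemma factorial_functional0 : factorial_functional 0 = 0.
Proof. by rewrite /factorial_functional size_poly0 big_ord0. Qed.

Lemma factorial_functionalZ a p :
  factorial_functional (a *: p) = a * factorial_functional p.
Proof.
by rewrite -[a *: p]addr0 factorial_functionalZD factorial_functional0 addr0.
Qed.

Lemma factorial_functional_sum (I : Type) (r : seq I) (P : pred I)
    (F : I -> {poly R}) :
  factorial_functional (\sum_(i <- r | P i) F i)
    = \sum_(i <- r | P i) factorial_functional (F i).
Proof.
elim/big_rec2: _ => [|i x y _ <-]; first exact: factorial_functional0.
by rewrite -[F i in LHS]scale1r factorial_functionalZD mul1r.
Qed.

Lemma factorial_functionalXn k : factorial_functional 'X^k = k`!%:R.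
Proof.
rewrite /factorial_functional size_polyXn (bigD1 ord_max) //= coefXn eqxx mul1r.
rewrite big1 ?addr0 // => i ik; rewrite coefXn.
by rewrite -val_eqE /= in ik; rewrite (negbTE ik) mul0r.
Qed.

(** Integration by parts in algebraic form: the terms of [q] and [q^`()] cancel
    in pairs because [(k.+1)`! = k.+1 * k`!], and only the constant term
    stays. *)
Lemma factorial_functional_sub_deriv q :
  factorial_functional (q - q^`()) = q.[0].
Proof.
rewrite -[q - _]addrC -scaleN1r factorial_functionalZD mulN1r.
rewrite (@factorial_functional_wide q (size q).+1) //.
rewrite (@factorial_functional_wide q^`() (size q)); last first.
  have [->|/lt_size_deriv/ltnW//] := eqVneq q 0; by rewrite deriv0 size_poly0.
rewrite big_ord_recl /= fact0 mulr1 horner_coef0 addrCA -sumrN -big_split /=.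
rewrite big1 ?addr0 // => i _; rewrite coef_deriv factS natrM.
by rewrite -(mulr_natr q`_i.+1) -mulrA addNr.
Qed.

End FactorialFunctional.

(** * The law of the first repeated color *)

Section FirstRepeat.
Variables (R : realType) (T : finType) (p : T -> R).

(** At [s], and multiplied by [exp (- s)], the density at time [s] of the event
    that the first repeat has color [i], for samples at Poisson times of rate
    1. *)
Definition first_repeat_poly (i : T) : {poly R} :=
  (p i ^+ 2) *: ('X * \prod_(j | j != i) (1 + p j *: 'X)).

(** Expanding the product over subsets [J], each monomial ['X^(#|J|.+1)] turns
    into the number of orders of [J] and the first copy of [i]. *)
Lemma first_repeat_lawE i :
  first_repeat_law p i = factorial_functional (first_repeat_poly i).
Proof.
have -> : first_repeat_poly i = (p i ^+ 2) *:
    \sum_(J : {set T} | i \notin J) (\prod_(j in J) p j) *: 'X^(#|J|.+1).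
  rewrite /first_repeat_poly; congr (_ *: _).
  under eq_bigr do rewrite addrC.
  rewrite big_mkcond /=.
  under eq_bigr => j _.
    rewrite (_ : (if _ then _ else _) = (if j != i then p j *: 'X else 0) + 1).
      over.
    by case: ifP; rewrite ?add0r.
  (* A factor 0 at [i] removes the sets that contain [i]. *)
  rewrite bigA_distr mulr_sumr [RHS]big_mkcond; apply: eq_bigr => J _.
  case: ifPn => [iJ|/negPn iJ]; last first.
    by rewrite (bigD1 i) //= iJ eqxx mul0r mulr0.
  rewrite -big_mkcond /= (eq_bigr (fun j => p j *: 'X)); last first.
    by move=> j jJ; case: eqP jJ iJ => // -> ->.
  by rewrite scaler_prod prodr_const exprS scalerAr.
rewrite factorial_functionalZ factorial_functional_sum /first_repeat_law.
congr (_ * _).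
rewrite (partition_big
  (fun J : {set T} => inord #|J| : 'I_#|T|.-1.+1) xpredT) //=.
have T0 : (0 < #|T|)%N by apply/card_gt0P; exists i.
rewrite -[in LHS](prednK T0); apply: eq_bigr => k _.
rewrite mulr_sumr; apply: eq_big => [J|J /andP[/eqP <- _]]; last first.
  by rewrite factorial_functionalZ factorial_functionalXn mulrC.
rewrite andbC; case iJ : (i \in J) => //=.
rewrite -val_eqE /= inordK // prednK //.
rewrite -cardsT proper_card // properT.
by apply: contraFneq iJ => ->; rewrite inE.
Qed.

(** A first repeat almost surely occurs.  The derivative of
    [\prod_j (1 + p_j X)] misses one factor in each term, and adding this factor
    back, weighted by [p_i], leaves [p_i ^ 2 X \prod_(j != i) (1 + p_j X)]. *)
Lemma first_repeat_law_sum : \sum_i p i = 1 ->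
  \sum_i first_repeat_law p i = 1.
Proof.
move=> p1; under eq_bigr do rewrite first_repeat_lawE.
rewrite -factorial_functional_sum.
pose q : {poly R} := \prod_j (1 + p j *: 'X).
have -> : \sum_i first_repeat_poly i = q - q^`(); last first.
  rewrite factorial_functional_sub_deriv horner_prod big1 // => j _.
  by rewrite !hornerE.
have dq : q^`() = \sum_i p i *: \prod_(j | j != i) (1 + p j *: 'X).
  rewrite deriv_prod_uniq ?index_enum_uniq //; apply: eq_bigr => i _.
  by rewrite derivD derivZ derivX -polyC1 derivC add0r -scalerAl mul1r.
have qE : q = \sum_i p i *: q by rewrite -scaler_suml p1 scale1r.
rewrite {1}qE dq -sumrB; apply: eq_bigr => i _.
rewrite -scalerBr [q](bigD1 i) //= mulrDl mul1r addrC addKr.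
by rewrite /first_repeat_poly expr2 -scalerA -scalerAl.
Qed.

(** The polynomials of [i] and [j] become equal after multiplication by the
    common missing factor, which is not a zero divisor. *)
Lemma first_repeat_law_eq i j : p i = p j ->
  first_repeat_law p i = first_repeat_law p j.
Proof.
move=> pij; rewrite !first_repeat_lawE /first_repeat_poly pij.
congr (factorial_functional (_ *: (_ * _))).
have nz : 1 + p j *: 'X != 0 :> {poly R}.
  apply/eqP => /(congr1 (fun r : {poly R} => r.[0])).
  by rewrite !hornerE => /eqP; rewrite oner_eq0.
have qE k : (1 + p k *: 'X) * \prod_(l | l != k) (1 + p l *: 'X)
    = \prod_l (1 + p l *: 'X) :> {poly R} by rewrite [RHS](bigD1 k).
by have := etrans (qE i) (esym (qE j)); rewrite pij => /(mulfI nz).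
Qed.

End FirstRepeat.

(** Differences that are all equal away from [i0] cannot cancel among
    themselves, so by balance their absolute values add up to [`|d i0|]. *)
Lemma half_norm_sum_balanced (R : realType) (T : finType) (d : T -> R)
    (i0 : T) (e : R) :
  \sum_i d i = 0 -> (forall i, i != i0 -> d i = e) ->
  2^-1 * \sum_i `|d i| = `|d i0|.
Proof.
rewrite !(bigD1 i0 _ (P := xpredT)) //= => d0 de.
have -> : \sum_(i | i != i0) `|d i| = `|\sum_(i | i != i0) d i|.
  under eq_bigr => i /de -> do [].
  under [in RHS]eq_bigr => i /de -> do [].
  by rewrite !sumr_const normrMn.
have -> : \sum_(i | i != i0) d i = - d i0.
  by apply/eqP; rewrite -addr_eq0 addrC d0.
by rewrite normrN; field.
Qed.

(** * Integrals of polynomials times exponentials of polynomials *)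

Section Laplace.
Variable R : realType.
Implicit Types p q : {poly R}.
Local Notation mu := (@lebesgue_measure R).

(** The term of degree [k.+1] of the exponential series already beats
    [t ^+ k]. *)
Lemma cvg_monomial_expRN k : (t : R) ^+ k * expR (- t) @[t --> +oo] --> (0 : R).
Proof.
apply: (@squeeze_cvgr _ _ _ _ (fun=> 0) (fun t => k.+1`!%:R * t^-1)).
- near=> t; have t0 : 0 < t by near: t; exact: nbhs_pinfty_gt.
  rewrite mulr_ge0 ?exprn_ge0 ?expR_ge0 ?(ltW t0) //=.
  rewrite expRN ler_pdivrMr ?expR_gt0 // mulrAC ler_pdivlMr // -exprSr.
  rewrite mulrC -ler_pdivrMr ?ltr0n ?fact_gt0 //.
  by rewrite (le_trans _ (expR_ge1Dxn k (ltW t0))) // lerDr.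
- exact: cvg_cst.
- rewrite -[X in _ --> X](mulr0 (k.+1`!%:R)); apply: cvgMl_tmp.
  apply/gtr0_cvgV0; [exact: nbhs_pinfty_gt|exact: cvg_id].
Unshelve. all: by end_near. Qed.

Lemma cvg_horner_expRN p : p.[t] * expR (- t) @[t --> +oo] --> (0 : R).
Proof.
(* The extra power of [t] makes the Horner induction go through. *)
suff H k : p.[t] * (t ^+ k * expR (- t)) @[t --> +oo] --> (0 : R).
  by have := H 0%N; under eq_fun do rewrite expr0 mul1r.
elim/poly_ind: p k => [|p c IHp] k.
  by under eq_fun do rewrite horner0 mul0r; exact: cvg_cst.
rewrite (_ : (fun t : R => _) = (fun t : R =>
    p.[t] * (t ^+ k.+1 * expR (- t)) + c * (t ^+ k * expR (- t)))); last first.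
  by apply/funext => t; rewrite hornerMXaddC exprS; ring.
rewrite (_ : 0 = 0 + c * 0 :> R); last by rewrite mulr0 addr0.
apply: cvgD; first exact: IHp.
by apply: cvgMl_tmp; exact: cvg_monomial_expRN.
Qed.

(** All functions integrated below have the form [p.[t] * expR q.[t]]; this
    class is closed under differentiation, and continuity and measurability need
    to be checked only once. *)
Lemma is_derive_horner_expR p q (t : R) :
  is_derive t 1 (fun t => p.[t] * expR q.[t])
    ((p^`() + p * q^`()).[t] * expR q.[t]).
Proof.
have de := @is_derive1_comp _ expR (horner q) t _ _
  (is_derive_expR q.[t]) (is_derive_poly q t).
apply: (is_derive_eq (is_deriveM (is_derive_poly p t) de)).
by rewrite !hornerE /GRing.scale /=; ring.
Qed.

Lemma continuous_horner_expR p q : continuous (fun t => p.[t] * expR q.[t]).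
Proof.
move=> t; apply: differentiable_continuous; apply/derivable1_diffP.
by case: (is_derive_horner_expR p q t).
Qed.

Lemma integral_horner_expR p q :
  (forall t, 0 <= t -> 0 <= (p^`() + p * q^`()).[t]) ->
  p.[t] * expR q.[t] @[t --> +oo] --> (0 : R) ->
  (\int[mu]_(t in `[0%R, +oo[) ((p^`() + p * q^`()).[t] * expR q.[t])%:E
   = (- (p.[0] * expR q.[0]))%:E)%E.
Proof.
move=> dp0 p0.
rewrite (@ge0_continuous_FTC2y _ _ (fun t => p.[t] * expR q.[t]) _ 0) //.
- by rewrite add0e EFinN.
- by move=> t t0; rewrite mulr_ge0 ?expR_ge0 ?dp0.
- by apply: continuous_subspaceT => t; exact: continuous_horner_expR.
- exact/cvg_at_right_filter/continuous_horner_expR.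
- by move=> t _; rewrite derive1E; case: (is_derive_horner_expR p q t).
Qed.

(** With such a [q], the function [- q.[t] * expR (- t)] is an antiderivative of
    [p.[t] * expR (- t)].  The sum of all iterated derivatives of [p] works. *)
Lemma sub_deriv_antiderivative p : exists q, q - q^`() = p.
Proof.
exists (\sum_(i < size p) p^`(i)).
rewrite raddf_sum /= -(big_mkord xpredT (fun i => p^`(i))).
rewrite -(big_mkord xpredT (fun i => (p^`(i))^`())).
under [X in _ - X]eq_bigr do rewrite -derivnS.
rewrite -opprB -sumrB telescope_sumr // derivn0 opprB.
by rewrite (@derivn_poly0 _ p) ?subr0.
Qed.

(** The rate [l] is the change of variables [s = l * t], kept explicit because
    the limit below needs the rate [sqrt n]. *)
Lemma integral_horner_expRN (l : R) p : 0 < l ->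
  (forall t, 0 <= t -> 0 <= p.[t]) ->
  (\int[mu]_(t in `[0%R, +oo[) (l * (p.[l * t] * expR (- (l * t))))%:E
   = (factorial_functional p)%:E)%E.
Proof.
move=> l0 p0; have [q qp] := sub_deriv_antiderivative p.
pose F := - (q \Po (l *: 'X)); pose G := - (l *: 'X : {poly R}).
have FG : F^`() + F * G^`() = l *: (p \Po (l *: 'X)).
  rewrite -qp /F /G !derivN deriv_comp derivZ derivX comp_polyB.
  rewrite -!mul_polyC mulr1.
  ring.
have FGt t : (F^`() + F * G^`()).[t] = l * p.[l * t].
  by rewrite FG hornerZ horner_comp !hornerE.
have Gt t : G.[t] = - (l * t) by rewrite /G !hornerE.
have := @integral_horner_expR F G.
under eq_integral do rewrite FGt Gt -mulrA.
rewrite Gt mulr0 oppr0 expR0 mulr1 /F hornerN horner_comp !hornerE opprK.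
rewrite -[q.[0]]factorial_functional_sub_deriv qp; apply.
- by move=> t t0; rewrite FGt mulr_ge0 ?p0 ?mulr_ge0 ?(ltW l0).
- under eq_fun do rewrite Gt hornerN horner_comp !hornerE mulNr.
  rewrite -oppr0; apply: cvgN.
  apply: (cvg_comp (fun t => l * t) (fun t => q.[t] * expR (- t))).
    exact: gt0_cvgMry.
  exact: cvg_horner_expRN.
Qed.

End Laplace.

(** * Quadratic and cubic exponential bounds on 1 + w *)

Section Log.
Variable R : realType.

(** The function [(1 + w) exp (- g(w))] is 1 at 0, and the hypothesis is the
    sign of its derivative.  The factor [e] is meant to be 1 or -1, to obtain
    lower and upper bounds for [1 + w] at once. *)
Lemma expRN_horner_1Dx_ge (e : R) (g : {poly R}) : g.[0] = 0 ->
  (forall w, 0 < w -> 0 <= e * (1 - (1 + w) * g^`().[w])) ->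
  forall w, 0 <= w -> e <= e * ((1 + w) * expR (- g.[w])).
Proof.
move=> g0 dg w w0.
pose p : {poly R} := e *: (1 + 'X).
have pE (t : R) : p.[t] * expR (- g).[t] = e * ((1 + t) * expR (- g.[t])).
  by rewrite !hornerE.
have := @ger0_derive1_ndecry _ (fun t => p.[t] * expR (- g).[t]) 0.
move=> /(_ _ _ _ 0 w (lexx _) w0).
rewrite !pE g0 oppr0 expR0 addr0 !mulr1; apply.
- by move=> t _; case: (is_derive_horner_expR p (- g) t).
- move=> t; rewrite in_itv /= andbT => t0; rewrite derive1E.
  case: (is_derive_horner_expR p (- g) t) => _ ->.
  rewrite mulr_ge0 ?expR_ge0 //.
  rewrite (_ : _.[t] = e * (1 - (1 + t) * g^`().[t])) ?dg //.
  by rewrite /p !derivZ derivD derivN derivX -polyC1 derivC !hornerE; ring.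
- by apply: continuous_subspaceT => t; exact: continuous_horner_expR.
Qed.

Let hornerS := (@hornerD R, @hornerN R, @hornerZ R, @hornerMn R, @hornerC R,
  @hornerX R, @hornerXn R).

Lemma expR_le1Dx (w : R) : 0 <= w -> expR (w - w ^+ 2 / 2) <= 1 + w.
Proof.
move=> w0; pose g : {poly R} := 'X - 2^-1 *: 'X^2.
have gt : g.[w] = w - w ^+ 2 / 2 by rewrite /g !hornerS; ring.
have := @expRN_horner_1Dx_ge 1 g.
move=> /(_ _ _ w w0).
rewrite !mul1r gt expRN ler_pdivlMr ?expR_gt0 // mul1r; apply.
  by rewrite /g !hornerS; ring.
move=> t t0; rewrite mul1r /g derivB derivX -polyC1 derivZ derivXn !hornerS.
rewrite (_ : 1 - _ = t ^+ 2) ?sqr_ge0 //= ?expr1; field; rewrite ?pnatr_eq0 //.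
Qed.

Lemma le_expR1Dx (w : R) : 0 <= w ->
  1 + w <= expR (w - w ^+ 2 / 2 + w ^+ 3 / 3).
Proof.
move=> w0; pose g : {poly R} := 'X - 2^-1 *: 'X^2 + 3^-1 *: 'X^3.
have gt : g.[w] = w - w ^+ 2 / 2 + w ^+ 3 / 3 by rewrite /g !hornerS; ring.
have := @expRN_horner_1Dx_ge (-1) g.
move=> /(_ _ _ w w0).
rewrite !mulN1r lerN2 gt expRN ler_pdivrMr ?expR_gt0 // mul1r; apply.
  by rewrite /g !hornerS; ring.
move=> t t0.
rewrite mulN1r /g !derivD derivN derivX -polyC1 !derivZ !derivXn !hornerS.
rewrite (_ : - (1 - _) = t ^+ 3) ?exprn_ge0 ?(ltW t0) //= ?expr1.
field; rewrite ?pnatr_eq0 //.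
Qed.

End Log.

(** * Pointwise convergence of the rescaled density *)

Lemma div_sqrtn_le1 (R : realType) (c : R) (n : nat) :
  0 < c -> (0 < n)%N -> c ^+ 2 <= n%:R -> c / Num.sqrt n%:R <= 1.
Proof.
move=> c0 n0 cn; have s0 : 0 < Num.sqrt n%:R :> R by rewrite sqrtr_gt0 ltr0n.
rewrite ler_pdivrMr // mul1r.
rewrite -(ler_pXn2r (n := 2)) ?nnegrE ?(ltW c0) ?(ltW s0) //.
by rewrite sqr_sqrtr ?ler0n.
Qed.

Section Limit.
Variables (R : realType) (c : R).
Hypothesis c0 : 0 < c.
Let s (n : nat) : R := Num.sqrt n%:R.

Lemma cvg_invr_sqrtn : (s n)^-1 @[n --> \oo] --> (0 : R).
Proof.
apply/gtr0_cvgV0.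
  by near=> n; rewrite sqrtr_gt0 ltr0n; near: n; exact: nbhs_infty_gt.
apply/cvgryPge => A; near=> n.
have [A0|A0] := ltP A 0; first by rewrite (le_trans (ltW A0)) ?sqrtr_ge0.
rewrite -(ler_pXn2r (n := 2)) ?nnegrE ?sqrtr_ge0 // sqr_sqrtr ?ler0n //.
by near: n; apply: nbhs_infty_ger.
Unshelve. all: by end_near. Qed.

(** With [1 + w] the base of the power, [n * w - sqrt n * t] is exactly
    [- c * t], while [n * w ^+ 2 / 2] tends to [t ^+ 2 / 2] and [n * w ^+ 3]
    tends to 0.  So the quadratic and the cubic bound on [1 + w] give the same
    limit. *)
Lemma cvg_scaled_exp (t : R) : 0 <= t ->
  (1 + t * (1 - c / s n) / s n) ^+ n * expR (- (s n * t)) @[n --> \oo]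
    --> expR (- (c * t) - t ^+ 2 / 2).
Proof.
move=> t0; pose a n := t * (1 - c / s n).
have at_ : a n @[n --> \oo] --> t.
  rewrite -[X in _ --> X]mulr1 -[X in _ * X]subr0 -[X in _ - X](mulr0 c).
  apply: cvgMl_tmp; apply: cvgB; first exact: cvg_cst.
  by apply: cvgMl_tmp; exact: cvg_invr_sqrtn.
have a2 : a n ^+ 2 / 2 @[n --> \oo] --> t ^+ 2 / 2.
  apply: cvgMr_tmp; rewrite !expr2.
  by under eq_fun do rewrite expr2; exact: cvgM.
have ct : (fun=> - (c * t)) @ \oo --> - (c * t) by exact: cvg_cst.
have low : expR (- (c * t) - a n ^+ 2 / 2) @[n --> \oo]
    --> expR (- (c * t) - t ^+ 2 / 2).
  by apply: (cvg_comp _ (@expR R)); [apply: cvgB ct a2|exact: continuous_expR].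
have up : expR (- (c * t) - a n ^+ 2 / 2 + a n ^+ 3 / 3 * (s n)^-1) @[n --> \oo]
    --> expR (- (c * t) - t ^+ 2 / 2).
  have a3 : a n ^+ 3 / 3 @[n --> \oo] --> t ^+ 3 / 3.
    apply: cvgMr_tmp; rewrite !exprS expr0 mulr1.
    under eq_fun do rewrite !exprS expr0 mulr1.
    by do 2! apply: cvgM => //.
  have := cvgD (cvgB ct a2) (cvgM a3 cvg_invr_sqrtn).
  rewrite mulr0 addr0 => e.
  by apply: (cvg_comp _ (@expR R)); [exact: e|exact: continuous_expR].
apply: (squeeze_cvgr _ low up); near=> n.
have n0 : (0 < n)%N by near: n; exact: nbhs_infty_gt.
have s0 : 0 < s n by rewrite sqrtr_gt0 ltr0n.
have s2 : s n ^+ 2 = n%:R by rewrite sqr_sqrtr ?ler0n.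
have cs : c / s n <= 1.
  by apply: div_sqrtn_le1 => //; near: n; apply: nbhs_infty_ger.
have an0 : 0 <= a n by rewrite mulr_ge0 // subr_ge0.
pose w := a n / s n; have w0 : 0 <= w by rewrite divr_ge0 ?(ltW s0).
rewrite -/(a n) -/w.
have sN : s n != 0 by rewrite gt_eqF.
have nw : n%:R * w - s n * t = - (c * t) by rewrite -s2 /w /a; field.
have nw2 : n%:R * w ^+ 2 = a n ^+ 2 by rewrite -s2 /w; field.
have nw3 : n%:R * w ^+ 3 = a n ^+ 3 / s n by rewrite -s2 /w; field.
apply/andP; split.
  apply: le_trans (_ : expR (w - w ^+ 2 / 2) ^+ n * expR (- (s n * t)) <= _).
    rewrite -expRM_natl -expRD ler_expR -nw -nw2; lra.
  rewrite ler_pM2r ?expR_gt0 // lerXn2r ?nnegrE ?expR_ge0 ?expR_le1Dx //.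
  by rewrite addr_ge0.
apply: (@le_trans _ _
  (expR (w - w ^+ 2 / 2 + w ^+ 3 / 3) ^+ n * expR (- (s n * t)))).
  rewrite ler_pM2r ?expR_gt0 //.
  by rewrite lerXn2r ?nnegrE ?expR_ge0 ?le_expR1Dx ?addr_ge0.
by rewrite -expRM_natl -expRD ler_expR -nw -nw2 [_ / 3 / _]mulrAC -nw3; lra.
Unshelve. all: by end_near. Qed.

End Limit.

(** * Limits of the probabilities of color 0 *)

Section Asymptotics.
Variables (R : realType) (c : R).
Hypothesis c0 : 0 < c.
Local Notation mu := (@lebesgue_measure R).
Local Notation limit_integrand :=
  (fun t => c ^+ 2 * t * expR (- (c * t) - t ^+ 2 / 2)).

Let phi (n : nat) (t : R) :=
  c ^+ 2 * t * ((1 + t * (1 - c / Num.sqrt n%:R) / Num.sqrt n%:R) ^+ n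
                * expR (- (Num.sqrt n%:R * t))).

Let phiE n : exists p q : {poly R}, phi n = fun t => p.[t] * expR q.[t].
Proof.
exists ((c ^+ 2 *: 'X)
  * (1 + ((1 - c / Num.sqrt n%:R) / Num.sqrt n%:R) *: 'X) ^+ n).
exists (- (Num.sqrt n%:R *: 'X)); apply/funext => t.
rewrite /phi.
rewrite !(hornerM, horner_exp, hornerD, hornerC, hornerN, hornerZ, hornerX).
by rewrite -[t * _ / _]mulrA [t * (_ / _)]mulrC mulrA.
Qed.

(** Poissonization at rate [sqrt n], the time scale of the first repeat. *)
Lemma first_repeat_law_two_level n : (0 < n)%N -> c ^+ 2 <= n%:R ->
  ((first_repeat_law (@two_level R n (c / Num.sqrt n%:R)) ord0)%:E
   = \int[mu]_(t in `[0%R, +oo[) (phi n t)%:E)%E.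
Proof.
move=> n0 cn; set s := Num.sqrt _.
have s0 : 0 < s by rewrite sqrtr_gt0 ltr0n.
have s2 : s ^+ 2 = n%:R by rewrite sqr_sqrtr ?ler0n.
have cs : c / s <= 1 by exact: div_sqrtn_le1.
have PE (t : R) : (first_repeat_poly (@two_level R n (c / s)) ord0).[t] =
    (c / s) ^+ 2 * (t * (1 + (1 - c / s) / n%:R * t) ^+ n).
  rewrite /first_repeat_poly hornerZ hornerM hornerX {1}/two_level eqxx.
  rewrite horner_prod.
  congr (_ * (_ * _)); rewrite big_mkcond big_ord_recl eqxx /= mul1r.
  rewrite (eq_bigr (fun=> 1 + (1 - c / s) / n%:R * t)).
    by rewrite prodr_const card_ord.
  by move=> i _; rewrite /two_level /= !(hornerD, hornerZ, hornerC, hornerX).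
rewrite first_repeat_lawE -(@integral_horner_expRN _ s) //; last first.
  move=> t t0; rewrite PE mulr_ge0 ?sqr_ge0 // mulr_ge0 //.
  apply: exprn_ge0; apply: addr_ge0 => //.
  by rewrite !mulr_ge0 ?invr_ge0 ?ler0n ?subr_ge0.
apply: eq_integral => t _; rewrite PE /phi -/s -s2; congr (_%:E).
have sN : s != 0 by rewrite gt_eqF.
rewrite (_ : (1 - c / s) / s ^+ 2 * (s * t) = t * (1 - c / s) / s).
  by field.
by field.
Qed.

Let limit_integrandE : exists p q : {poly R},
  limit_integrand = fun t => p.[t] * expR q.[t].
Proof.
exists (c ^+ 2 *: 'X), (- (c *: 'X) - 2^-1 *: 'X^2); apply/funext => t.
by rewrite !(hornerD, hornerN, hornerZ, hornerX, hornerXn) [_ / 2]mulrC.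
Qed.

Let measurable_horner_expR (f : R -> R) :
  (exists p q : {poly R}, f = fun t => p.[t] * expR q.[t]) ->
  measurable_fun (`[0%R, +oo[%classic : set R) f.
Proof.
move=> [p [q ->]]; apply: measurable_funTS.
by apply: continuous_measurable_fun; exact: continuous_horner_expR.
Qed.

Lemma cvg_first_repeat_law_two_level :
  first_repeat_law (@two_level R n (c / Num.sqrt n%:R)) ord0 @[n --> \oo] -->
  \int[mu]_(t in `[0, +oo[) limit_integrand t.
Proof.
pose N := (Num.truncn (c ^+ 2)).+1.
have NP n : (0 < n + N)%N /\ c ^+ 2 <= (n + N)%:R.
  split; first by rewrite addnS.
  have /ltW cN : c ^+ 2 < N%:R by exact: truncnS_gt.
  by rewrite (le_trans cN) // ler_nat leq_addl.
(* For [n >= N], [c <= sqrt n], so [1 - c / sqrt n] is nonnegative, which the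
   domination and the integral formula need. *)
rewrite -(cvg_shiftn N) /=.
have [| | | | |ig _ cvg_int] := @dominated_convergence _ _ _ mu
  `[0%R, +oo[%classic (measurable_itv _) (fun n t => (phi (n + N) t)%:E)
  (fun t => (limit_integrand t)%:E)
  (fun t => (c * ('X.[c * t] * expR (- (c * t))))%:E).
- by move=> n; apply/measurable_EFinP; apply: measurable_horner_expR.
- by apply/measurable_EFinP; apply: measurable_horner_expR limit_integrandE.
- apply/aeW => t; rewrite /= in_itv /= andbT => t0.
  apply: cvg_EFin; first by near=> n.
  apply: cvgMl_tmp.
  have := cvg_scaled_exp c0 t0; rewrite -(cvg_shiftn N) /=; exact.
- apply/integrableP; split.
    apply/measurable_EFinP; apply: measurable_horner_expR.
    exists (c ^+ 2 *: 'X), (- (c *: 'X)).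
    by apply/funext => t; rewrite !(hornerN, hornerZ, hornerX); ring.
  have L := @integral_horner_expRN R c 'X c0.
  under eq_integral => t.
    rewrite inE /= in_itv /= andbT => t0.
    rewrite /= ger0_norm; last first.
      by rewrite hornerX !mulr_ge0 ?expR_ge0 ?(ltW c0).
    over.
  by rewrite L ?ltry // => t; rewrite hornerX.
- apply/aeW => t n; rewrite /= in_itv /= andbT => t0.
  have [n0 cn] := NP n; rewrite /phi; set m := (n + N)%N in n0 cn *.
  set s := Num.sqrt _.
  have s0 : 0 < s by rewrite sqrtr_gt0 ltr0n.
  have s2 : s ^+ 2 = m%:R by rewrite sqr_sqrtr ?ler0n.
  have cs : c / s <= 1 by exact: div_sqrtn_le1.
  set w := t * (1 - c / s) / s.
  have w0 : 0 <= w.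
    apply: divr_ge0; last exact: ltW.
    by apply: mulr_ge0 => //; rewrite subr_ge0.
  rewrite lee_fin ger0_norm; last first.
    by apply: mulr_ge0; apply: mulr_ge0;
      rewrite ?sqr_ge0 ?expR_ge0 ?exprn_ge0 ?addr_ge0.
  rewrite hornerX.
  rewrite (_ : c * (c * t * _) = c ^+ 2 * t * expR (- (c * t))); last by ring.
  rewrite ler_wpM2l ?(mulr_ge0 (sqr_ge0 c) t0) //.
  have -> : - (c * t) = m%:R * w - s * t.
    by rewrite -s2 /w; field; rewrite gt_eqF.
  rewrite expRD expRM_natl ler_wpM2r ?expR_ge0 //.
  by rewrite lerXn2r ?nnegrE ?expR_ge0 ?addr_ge0 ?expR_ge1Dx.
have fin : (\int[mu]_(t in `[0%R, +oo[) (limit_integrand t)%:E)%E \is a fin_num.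
  by apply: integrable_fin_num ig.
rewrite -(fineK fin) in cvg_int.
apply: cvg_trans (fine_cvg cvg_int); apply: near_eq_cvg; near=> n => /=.
by have [n0 cn] := NP n; rewrite -first_repeat_law_two_level.
Unshelve. all: by end_near. Qed.

(** With [k = c ^ 2 / (1 + c ^ 2)], in the derivative of
    [- k * (1 + c * t) * exp (- c t - t ^ 2 / 2)] the exponential is multiplied
    by [c ^ 2 * t + k * c * t ^ 2], which dominates [c ^ 2 * t].  The constant
    term of this factor vanishes by the choice of the affine factor [1 + c * t],
    and [k] makes the coefficient of [t] exact. *)
Lemma limit_discrepancy_ge0 : 0 <= limit_discrepancy c.
Proof.
rewrite /limit_discrepancy subr_ge0.
have [k kE] : exists k, k = c ^+ 2 / (1 + c ^+ 2).
  by exists (c ^+ 2 / (1 + c ^+ 2)).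
have c21 : 0 < 1 + c ^+ 2 by rewrite ltr_pwDl ?sqr_ge0.
have k0 : 0 <= k by rewrite kE divr_ge0 ?sqr_ge0 ?(ltW c21).
pose p : {poly R} := - (k *: (1 + c *: 'X)).
pose q : {poly R} := - (c *: 'X) - 2^-1 *: 'X^2.
have qE t : q.[t] = - (c * t) - t ^+ 2 / 2.
  by rewrite /q !(hornerD, hornerN, hornerZ, hornerX, hornerXn) [_ / 2]mulrC.
have pE t : p.[t] = - (k * (1 + c * t)).
  by rewrite /p !(hornerD, hornerN, hornerZ, hornerX, hornerC).
have dE t : (p^`() + p * q^`()).[t] = c ^+ 2 * t + k * c * t ^+ 2.
  rewrite hornerD hornerM pE /p /q !(derivD, derivN, derivZ, derivX, derivXn).
  rewrite -polyC1 derivC.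
  rewrite !(hornerD, hornerN, hornerZ, hornerX, hornerXn, hornerC, hornerMn) /=.
  rewrite kE.
  by field; rewrite gt_eqF.
have : (\int[mu]_(t in `[0%R, +oo[)
    ((p^`() + p * q^`()).[t] * expR q.[t])%:E)%E = k%:E.
  rewrite (@integral_horner_expR R p q).
  - rewrite pE qE !mulr0 expr0n /= mul0r addr0 subr0 oppr0 expR0 !mulr1.
    by rewrite opprK.
  - move=> t t0; rewrite dE; apply: addr_ge0.
      exact: mulr_ge0 (sqr_ge0 _) t0.
    exact: mulr_ge0 (mulr_ge0 k0 (ltW c0)) (sqr_ge0 _).
  - pose h : {poly R} := 1 + 'X.
    have h0 : h.[c * t] * expR (- (c * t)) @[t --> +oo] --> (0 : R).
      apply: (cvg_comp (fun t => c * t) (fun t => h.[t] * expR (- t))).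
        exact: gt0_cvgMry.
      exact: cvg_horner_expRN.
    have kh0 : k * (h.[c * t] * expR (- (c * t))) @[t --> +oo] --> (k * 0 : R).
      by apply: cvgMl_tmp.
    have low : - (k * (h.[c * t] * expR (- (c * t)))) @[t --> +oo] --> (0 : R).
      rewrite (_ : 0 = - (k * 0)); last by rewrite mulr0 oppr0.
      apply: cvgN; exact: kh0.
    apply: (squeeze_cvgr _ low (cvg_cst _)); near=> t.
    have t0 : 0 <= t by near: t; exact: nbhs_pinfty_ge.
    have ct0 : 0 <= 1 + c * t by rewrite addr_ge0 // mulr_ge0 ?(ltW c0).
    rewrite pE qE /h hornerD hornerC hornerX mulNr -mulrA oppr_le0 lerN2.
    apply/andP; split; last exact: mulr_ge0 k0 (mulr_ge0 ct0 (expR_ge0 _)).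
    rewrite ler_wpM2l // ler_wpM2l // ler_expR.
    by rewrite gerDl oppr_le0 divr_ge0 ?sqr_ge0.
move=> I1; rewrite -kE -lee_fin -I1.
have le1 : (\int[mu]_(t in `[0%R, +oo[) (limit_integrand t)%:E <=
   \int[mu]_(t in `[0%R, +oo[)
     ((p^`() + p * q^`()).[t] * expR q.[t])%:E)%E.
  apply: ge0_le_integral => //.
  - move=> t; rewrite /= in_itv /= andbT => t0.
    by rewrite lee_fin mulr_ge0 ?expR_ge0 // mulr_ge0 ?sqr_ge0.
  - by apply/measurable_EFinP; apply: measurable_horner_expR limit_integrandE.
  - apply/measurable_EFinP; apply: measurable_horner_expR.
    by exists (p^`() + p * q^`()), q.
  - move=> t; rewrite /= in_itv /= andbT => t0.
    rewrite lee_fin qE dE ler_wpM2r ?expR_ge0 // lerDl.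
    exact: mulr_ge0 (mulr_ge0 k0 (ltW c0)) (sqr_ge0 _).
rewrite /Rintegral fineK // ge0_fin_numE.
  by rewrite (le_lt_trans le1) // I1 ltry.
apply: integral_ge0 => t; rewrite /= in_itv /= andbT => t0.
by rewrite lee_fin mulr_ge0 ?expR_ge0 // mulr_ge0 ?sqr_ge0.
Unshelve. all: by end_near. Qed.

Lemma cvg_pair_law_two_level :
  pair_law (@two_level R n (c / Num.sqrt n%:R)) ord0 @[n --> \oo] -->
  c ^+ 2 / (1 + c ^+ 2).
Proof.
have x0 : c / Num.sqrt n%:R @[n --> \oo] --> (0 : R).
  by rewrite -[X in _ --> X](mulr0 c); apply: cvgMl_tmp; exact: cvg_invr_sqrtn.
have y1 : 1 - c / Num.sqrt n%:R @[n --> \oo] --> (1 - 0 : R).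
  by apply: cvgB; [exact: cvg_cst|exact: x0].
have lim : c ^+ 2 / (c ^+ 2 + (1 - c / Num.sqrt n%:R) ^+ 2) @[n --> \oo]
    --> c ^+ 2 / (c ^+ 2 + (1 - 0) ^+ 2).
  apply: cvgMl_tmp; apply: cvgV.
    by rewrite subr0 expr1n gt_eqF // ltr_wpDl ?sqr_ge0.
  apply: cvgD; first exact: cvg_cst.
  by rewrite expr2; under eq_fun do rewrite expr2; exact: cvgM.
rewrite subr0 expr1n addrC in lim.
apply: cvg_trans lim; apply: near_eq_cvg; near=> n.
have n0 : (0 < n)%N by near: n; exact: nbhs_infty_gt.
set s := Num.sqrt _.
have s0 : 0 < s by rewrite sqrtr_gt0 ltr0n.
have s2 : s ^+ 2 = n%:R by rewrite sqr_sqrtr ?ler0n.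
have sN : s != 0 by rewrite gt_eqF.
have -> : pair_law (@two_level R n (c / s)) ord0 =
    (c / s) ^+ 2 / ((c / s) ^+ 2 + (1 - c / s) ^+ 2 / s ^+ 2).
  rewrite /pair_law big_ord_recl /two_level eqxx /=; congr (_ / (_ + _)).
  rewrite sumr_const card_ord -[_ *+ n]mulr_natr -s2.
  by field.
field; rewrite sN gt_eqF // ltr_pwDl ?sqr_ge0 // exprn_gt0 //.
exact: mulr_gt0.
Unshelve. all: by end_near. Qed.

End Asymptotics.

(** * Reduction to color 0 and conclusion *)

Lemma discrepancy_two_level (R : realType) (n : nat) (x : R) :
  (0 < n)%N -> 0 < x <= 1 ->
  discrepancy (@two_level R n x)
    = `|pair_law (@two_level R n x) ord0
        - first_repeat_law (@two_level R n x) ord0|.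
Proof.
move=> n0 /andP[x0 x1].
have [_ p1] : is_distribution (@two_level R n x).
  by apply: two_level_distribution; rewrite ?(ltW x0).
set p := @two_level R n x in p1 *.
have pE i : i != ord0 -> p i = p ord_max.
  move=> i0; rewrite /p /two_level (negbTE i0) ifN // -val_eqE /=.
  by rewrite -lt0n.
rewrite /discrepancy (@half_norm_sum_balanced _ _ _ ord0
  (pair_law p ord_max - first_repeat_law p ord_max)) //.
  rewrite sumrB first_repeat_law_sum // /pair_law -mulr_suml divff ?subrr //.
  rewrite gt_eqF // big_ord_recl ltr_pwDl //.
    by rewrite /p /two_level eqxx exprn_gt0.
  by apply: sumr_ge0 => i _; exact: sqr_ge0.
move=> i i0; rewrite (first_repeat_law_eq (pE i i0)) /pair_law.
by rewrite (pE i i0).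
Qed.

Theorem theorem2 (R : realType) (c : R) (hc : 0 < c) :
  discrepancy (@two_level R n (c / Num.sqrt n%:R)) @[n --> \oo]
    --> limit_discrepancy c.
Proof.
rewrite -(ger0_norm (limit_discrepancy_ge0 hc)).
have lim : `|pair_law (@two_level R n (c / Num.sqrt n%:R)) ord0
    - first_repeat_law (@two_level R n (c / Num.sqrt n%:R)) ord0| @[n --> \oo]
    --> `|limit_discrepancy c|.
  apply: cvg_norm; apply: cvgB; first exact: cvg_pair_law_two_level.
  exact: cvg_first_repeat_law_two_level.
apply: cvg_trans lim; apply: near_eq_cvg; near=> n => /=.
have n0 : (0 < n)%N by near: n; exact: nbhs_infty_gt.
have s0 : 0 < Num.sqrt n%:R :> R by rewrite sqrtr_gt0 ltr0n.
rewrite discrepancy_two_level // divr_gt0 //= div_sqrtn_le1 //.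
by near: n; apply: nbhs_infty_ger.
Unshelve. all: by end_near. Qed.
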